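(* Consider a finite MDP $\langle\mathcal S,\mathcal A,(\mathcal A(s),s\in\mathcal S),P,r\rangle$ (with $r$ interpreted as a cost) such that the Markov chain under every randomized stationary policy $u\in\mathcal U^{\rm RS}$ is ergodic (irreducible and aperiodic), and let $\alpha\in(0,1]$. Given a policy $u\in\mathcal U^{\rm DS}$, let $\mathrm{VaR}^u_-(\Lambda)$ be the left predecessor of $\mathrm{VaR}^u$ in $\Lambda$. (a) If there exists another policy $u'\in\mathcal U^{\rm DS}$ such that $F^{u'}(\mathrm{VaR}^u_-(\Lambda))\ge\alpha$, then $\mathrm{VaR}^{u'}<\mathrm{VaR}^u$. (b) The policy $u$ is optimal for the steady-state VaR minimization MDP, i.e. $\mathrm{VaR}^u=\inf_{v\in\mathcal U^{\rm RS}}\mathrm{VaR}^v$, if and only if $F^*(\mathrm{VaR}^u_-(\Lambda))<\alpha$, where $F^*(\lambda):=\sup_{v\in\mathcal U^{\rm RS}}F^v(\lambda)$.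
   Context: MDP: $\mathcal S$ and $\mathcal A$ are finite sets; $\mathcal A(s)\subseteq\mathcal A$ is the nonempty set of admissible actions in $s$, with $\cup_s\mathcal A(s)=\mathcal A$; $\mathcal K:=\{(s,a):s\in\mathcal S,a\in\mathcal A(s)\}$; $P(\cdot|s,a)$ is a probability distribution on $\mathcal S$ for each $(s,a)\in\mathcal K$; $r:\mathcal K\to\mathbb R$ is the instantaneous cost. Policies: $\mathcal U^{\rm RS}$ is the set of randomized stationary policies, i.e. maps $s\mapsto u(\cdot|s)$ with $u(\cdot|s)$ a probability distribution on $\mathcal A(s)$; $\mathcal U^{\rm DS}$ is the subset of deterministic ones (maps $u:\mathcal S\to\mathcal A$ with $u(s)\in\mathcal A(s)$). Under $u$, the state process is a Markov chain on $\mathcal S$ with transition matrix $\sum_{a}u(a|s)P(s'|s,a)$, and $\pi^u(s,a):=\lim_{t\to\infty}\mathbb P^u_{s_0}(s_t=s,a_t=a)$, which by ergodicity exists and does not depend on $s_0$. Steady-state quantities: $R^u_\infty$ is the random variable $r(s,a)$ with $(s,a)\sim\pi^u$; $\Lambda:=\{r(s,a):(s,a)\in\mathcal K\}$; for $\lambda\in\mathbb R$, $F^u(\lambda):=\mathbb P(R^u_\infty\le\lambda)$; $\mathrm{VaR}^u:=\inf\{\lambda\in\mathbb R:F^u(\lambda)\ge\alpha\}$. Left predecessor of $\lambda\in\mathbb R$ in the finite set $\Lambda$: $\lambda_-(\Lambda):=\max\{y\in\Lambda:y<\lambda\}$ if $\lambda>\min\Lambda$, and $\lambda_-(\Lambda):=\lambda-1$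 if $\lambda\le\min\Lambda$. *)

(* Defs.v *)
From HB Require Import structures.
From mathcomp Require Import all_boot all_order all_algebra.
From mathcomp Require Import all_classical all_reals all_analysis.

Set Implicit Arguments.
Unset Strict Implicit.
Unset Printing Implicit Defensive.

Import Order.TTheory GRing.Theory Num.Theory.
Import numFieldNormedType.Exports.

Local Open Scope classical_set_scope.
Local Open Scope ring_scope.

(* The transition law and the cost are total functions, but only their values *)
(* at admissible pairs are constrained or used. [trans M s a s'] is P(s'|s,a).*)
Record mdp (R : realType) (S A : finType) := MDP {
  adm : S -> {set A};
  trans : S -> A -> S -> R;
  cost : S -> A -> R;
  adm_nonempty : forall s, exists a, a \in adm s;
  adm_cover : forall a, exists s, a \in adm s;
  trans_ge0 : forall s a, a \in adm s -> forall s', 0 <= trans s a s';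
  trans_sum1 : forall s a, a \in adm s -> \sum_(s' : S) trans s a s' = 1 }.

Section MDP.
Variables (R : realType) (S A : finType) (M : mdp R S A).

(* [u s a] is u(a|s). *)
Definition RS_policies : set (S -> A -> R) :=
  [set u | forall s, [/\ forall a, 0 <= u s a,
                         forall a, a \notin adm M s -> u s a = 0
                       & \sum_(a in adm M s) u s a = 1]].

Definition DS_policies : set (S -> A) := [set u | forall s, u s \in adm M s].

Definition RS_of_DS (u : S -> A) : S -> A -> R := fun s a => (a == u s)%:R.

Definition chain_mx (u : S -> A -> R) : 'M[R]_#|S| :=
  \matrix_(i, j) \sum_(a in adm M (enum_val i))
     u (enum_val i) a * trans M (enum_val i) a (enum_val j).

Definition step_prob (Q : 'M[R]_#|S|) (t : nat) (s s' : S) : R :=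
  (Q ^+ t) (enum_rank s) (enum_rank s').

Definition irreducible_chain (Q : 'M[R]_#|S|) : Prop :=
  forall s s', exists t, 0 < step_prob Q t s s'.

(* The gcd of the set of positive return times is 1: its only common divisor  *)
(* is 1.                                                                      *)
Definition aperiodic_chain (Q : 'M[R]_#|S|) : Prop :=
  forall s (d : nat),
    (forall t, (0 < t)%N -> 0 < step_prob Q t s s -> (d %| t)%N) -> d = 1%N.

Definition ergodic_chain (Q : 'M[R]_#|S|) : Prop :=
  irreducible_chain Q /\ aperiodic_chain Q.

(* [w k] is the pair (s_k, a_k).                                              *)
Definition traj_prob (u : S -> A -> R) (s0 : S) (t : nat)
    (w : {ffun 'I_t.+1 -> S * A}) : R :=
  ((w ord0).1 == s0)%:R
  * \prod_(k < t.+1) u (w k).1 (w k).2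
  * \prod_(k < t) (let x := w (widen_ord (leqnSn t) k) in
                   trans M x.1 x.2 (w (lift ord0 k)).1).

Definition occ_prob (u : S -> A -> R) (s0 : S) (t : nat) (s : S) (a : A) : R :=
  \sum_(w : {ffun 'I_t.+1 -> S * A} | w ord_max == (s, a)) traj_prob u s0 w.

(* The limit exists and is independent of s0 when the chain of u is ergodic;  *)
(* otherwise [limn] may be a default value.                                   *)
Definition steady (s0 : S) (u : S -> A -> R) (s : S) (a : A) : R :=
  limn (fun t : nat => occ_prob u s0 t s a).

Definition cost_values : set R :=
  [set y | exists s a, a \in adm M s /\ y = cost M s a].

(* F^u; like VaR and Fstar below, it carries the initial state s0 from which  *)
(* the limiting distribution is computed.                                     *)
Definition cost_cdf (s0 : S) (u : S -> A -> R) (l : R) : R :=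
  \sum_(s : S) \sum_(a in adm M s | cost M s a <= l) steady s0 u s a.

Definition VaR (alpha : R) (s0 : S) (u : S -> A -> R) : R :=
  inf [set l | alpha <= cost_cdf s0 u l].

Definition Fstar (s0 : S) (l : R) : R :=
  sup [set cost_cdf s0 v l | v in RS_policies].

End MDP.

(* Meant for a finite nonempty L, where inf L is min L and, above it, the sup *)
(* is a max.                                                                  *)
Definition left_pred (R : realType) (L : set R) (l : R) : R :=
  if inf L < l then sup [set y | L y /\ y < l] else l - 1.

(* Main.v *)
(* The chain of an ergodic policy converges by Doeblin's contraction, so the   *)
(* steady-state law is the unique stationary one and F^v(l) is a linear        *)
(* functional of the occupation measure of v. The occupation measures of the   *)
(* randomized stationary policies are exactly the points of a compact          *)
(* polytope, hence the supremum F^*(l) is attained by some policy v. No value  *)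
(* of the cost lies strictly between VaR^u_- and VaR^u, therefore              *)
(* F^v(VaR^u_-) < alpha means exactly VaR^u <= VaR^v, and attainment turns     *)
(* the comparison over all v into one with F^*.                                *)
Require Import Defs.
From HB Require Import structures.
From mathcomp Require Import all_boot all_order all_algebra.
From mathcomp Require Import all_classical all_reals all_analysis.
From mathcomp Require Import ring lra zify.

Set Implicit Arguments.
Unset Strict Implicit.
Unset Printing Implicit Defensive.

Import Order.TTheory GRing.Theory Num.Theory.
Import numFieldNormedType.Exports.

Local Open Scope classical_set_scope.
Local Open Scope ring_scope.

(** VaR is a quantile of a law on the finite set of costs. If F^v(VaR^u_-) >= alpha, then VaR^v is
    at most VaR^u_- ([VaR_le]), which is below VaR^u ([left_pred_lt]); this gives (a). If
    F^v(VaR^u_-) < alpha, no level below VaR^u reaches alpha under v ([le_VaR_left_pred]).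
    Optimality of u thus means F^v(VaR^u_-) < alpha for every v, and this strict bound passes to the
    supremum because the supremum is attained ([Fstar_attained]).

    Attainment combines compactness of the set of occupation measures ([occ_polytope_compact]) with
    the fact that each of them comes from a policy ([occ_polytope_steady]). The latter rests on
    convergence of ergodic chains ([ergodic_cvg]) and uniqueness of their stationary law
    ([stationary_unique]). *)

(** * Additive semigroups of natural numbers with gcd 1 *)

Section AdditiveSemigroup.
Variable T : nat -> Prop.
Hypothesis TD : forall m n, T m -> T n -> T (m + n)%N.

Lemma semigroup_addMn m n k : T m -> T n -> T (m + k * n)%N.
Proof.
move=> Tm Tn; elim: k => [|k IHk]; first by rewrite mul0n addn0.
by rewrite mulSn addnCA; exact: TD.
Qed.

(* The least positive difference between two elements divides every element,  *)
(* so two elements are consecutive.                                           *)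
Lemma semigroup_cofinite :
  (forall d, (forall t, (0 < t)%N -> T t -> (d %| t)%N) -> d = 1%N) ->
  exists N, forall n, (N <= n)%N -> T n.
Proof.
move=> T1.
have [t0 t0_gt0 Tt0] : exists2 t, (0 < t)%N & T t.
  apply: contrapT => noT.
  suff : 2%N = 1%N by [].
  by apply: T1 => t t_gt0 Tt; case: noT; exists t.
pose D d := (0 < d)%N /\ exists2 m, T m & T (m + d)%N.
have exD : exists d, `[< D d >].
  exists t0; apply/asboolP; split=> //; exists t0 => //; exact: TD.
case: (ex_minnP exD) => d /asboolP[d_gt0 [m Tm Tmd]] d_min.
have d1 : d = 1%N.
  apply: T1 => t t_gt0 Tt; rewrite /dvdn -leqn0 leqNgt; apply/negP => r_gt0.
  have r_lt : (t %% d < d)%N by rewrite ltn_mod.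
  (* With q = t %/ d, the elements t + (q + 1) m and (q + 1)(m + d) differ by d - t %% d, a positive
     difference smaller than d. *)
  suff /d_min : `[< D (d - t %% d)%N >] by lia.
  apply/asboolP; split; first by rewrite subn_gt0.
  exists (t + (t %/ d).+1 * m)%N; first exact: semigroup_addMn.
  have -> : (t + (t %/ d).+1 * m + (d - t %% d) =
      (m + d) + (t %/ d) * (m + d))%N.
    rewrite {1}(divn_eq t d); nia.
  exact: semigroup_addMn.
move: Tmd; rewrite d1 => Tm1 {d_min d_gt0 d1 d}.
(* Both p = 2m + 1 and p + 1 are in [T], and p > 0 even if m = 0. If n = q p + r with r < p <= q,
   then n = (q - r) p + r (p + 1), where q - r > 0. *)
exists ((m + (m + 1)) * (m + (m + 1)))%N => n.
set p := (m + (m + 1))%N => le_pp_n.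
have p_gt0 : (0 < p)%N by rewrite /p; lia.
have Tp : T p by exact: TD.
have Tp1 : T p.+1 by rewrite (_ : p.+1 = (m + 1) + (m + 1))%N; [exact: TD|lia].
have r_lt : (n %% p < p)%N by rewrite ltn_mod.
have q_ge : (p <= n %/ p)%N by rewrite leq_divRL.
rewrite (_ : n = p + (n %/ p - n %% p).-1 * p + (n %% p) * p.+1)%N.
  by apply: semigroup_addMn => //; exact: semigroup_addMn.
rewrite {1}(divn_eq n p); nia.
Qed.

End AdditiveSemigroup.

(** * Stochastic matrices and Doeblin's contraction *)

Section StochasticMatrix.
Variables (R : realType) (n : nat).
Implicit Types P W : 'M[R]_n.

Definition stochastic P : Prop :=
  (forall i j, 0 <= P i j) /\ (forall i, \sum_j P i j = 1).

Lemma stochasticX P t : stochastic P -> stochastic (P ^+ t).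
Proof.
move=> [P0 P1]; elim: t => [|t [IH0 IH1]].
  split=> i => [j|]; first by rewrite expr0 mxE; case: (_ == _).
  rewrite expr0 (bigD1 i)//= mxE eqxx big1 ?addr0// => j ij.
  by rewrite mxE eq_sym (negbTE ij).
rewrite exprSr -mulmxE; split=> i => [j|].
  by rewrite mxE sumr_ge0// => k _; rewrite mulr_ge0.
under eq_bigr do rewrite mxE.
rewrite exchange_big/= -(IH1 i); apply: eq_bigr => k _.
by rewrite -mulr_sumr P1 mulr1.
Qed.

(** The average exceeds [a] by a sum of nonnegative terms, of which the one at [k] is at least c (x
    k - a). *)
Lemma stochastic_ge W (x : 'I_n -> R) c k a i : stochastic W ->
  c <= W i k -> (forall l, a <= x l) -> a + c * (x k - a) <= \sum_l W i l * x l.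
Proof.
move=> [W0 W1] cW ax.
have -> : \sum_l W i l * x l = a + \sum_l W i l * (x l - a).
  rewrite -[X in X + _]mul1r -(W1 i) mulr_suml -big_split/=.
  by apply: eq_bigr => l _; ring.
rewrite lerD2l (bigD1 k)//= ler_wpDr//; last by rewrite ler_wpM2r ?subr_ge0.
by apply: sumr_ge0 => l _; rewrite mulr_ge0 ?subr_ge0.
Qed.

Lemma stochastic_le W (x : 'I_n -> R) c k b i : stochastic W ->
  c <= W i k -> (forall l, x l <= b) -> \sum_l W i l * x l <= b - c * (b - x k).
Proof.
move=> sW cW xb; have xb' l : - b <= - x l by rewrite lerN2.
have := stochastic_ge sW cW xb'.
under eq_bigr do rewrite mulrN.
rewrite sumrN; lra.
Qed.

(* Doeblin's condition [c <= (P ^+ N) i k] makes the oscillation of the       *)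
(* columns of [P ^+ t] shrink by a factor [1 - c] every [N] steps.            *)
Lemma doeblin_cvg P N (k : 'I_n) (c : R) : stochastic P -> 0 < c ->
  (forall i, c <= (P ^+ N) i k) ->
  exists pi : 'I_n -> R,
    forall i j, (fun t => (P ^+ t) i j) @ \oo --> pi j.
Proof.
move=> sP c_gt0 cP.
suff H j : exists p : R, forall i, (fun t => (P ^+ t) i j) @ \oo --> p.
  by exists (fun j => projT1 (cid (H j))) => i j; case: cid => p /= /(_ i).
pose x t i := (P ^+ t) i j.
(* [a] and [b] are the extremes of column [j]. Each later column averages the entries of an earlier
   one, so [a] increases and [b] decreases. *)
pose a t := \big[Order.min/x t k]_i x t i.
pose b t := \big[Order.max/x t k]_i x t i.
have xD s t i : x (s + t)%N i = \sum_l (P ^+ s) i l * x t l.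
  by rewrite /x exprD -mulmxE mxE.
have ax t i : a t <= x t i by apply: bigmin_le.
have xb t i : x t i <= b t by apply: le_bigmax.
have aP t y : (forall i, y <= x t i) -> y <= a t.
  by move=> H; apply: le_bigmin.
have bP t y : (forall i, x t i <= y) -> b t <= y.
  by move=> H; apply: bigmax_le.
have W0 s i : 0 <= (P ^+ s) i k by case: (stochasticX s sP).
have a_nd : nondecreasing_seq a.
  move=> t s /subnK <-; apply: aP => i; rewrite xD.
  have := stochastic_ge (stochasticX _ sP) (W0 _ i) (ax t).
  by rewrite mul0r addr0; apply.
have b_ni : nonincreasing_seq b.
  move=> t s /subnK <-; apply: bP => i; rewrite xD.
  have := stochastic_le (stochasticX _ sP) (W0 _ i) (xb t).
  by rewrite mul0r subr0; apply.
have ab t : a t <= b t by exact: le_trans (ax t k) (xb t k).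
have ca : cvgn a.
  apply: nondecreasing_is_cvgn => //; exists (b 0%N) => _ [t _ <-].
  exact: le_trans (ab t) (b_ni _ _ _).
have cb : cvgn b.
  apply: nonincreasing_is_cvgn => //; exists (a 0%N) => _ [t _ <-].
  exact: le_trans (a_nd _ _ _) (ab t).
(* Both estimates use the same entry [x t k], which cancels when they are subtracted. *)
have contr t : b (t + N)%N - a (t + N)%N <= (1 - c) * (b t - a t).
  have Ha : a t + c * (x t k - a t) <= a (t + N)%N.
    by apply: aP => i; rewrite addnC xD; exact: stochastic_ge (stochasticX _ sP) _ _.
  have Hb : b (t + N)%N <= b t - c * (b t - x t k).
    by apply: bP => i; rewrite addnC xD; exact: stochastic_le (stochasticX _ sP) _ _.
  nra.
have cD : (fun t => b t - a t) @ \oo --> limn b - limn a by exact: cvgB.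
have lim_eq : limn b = limn a.
  apply/eqP; rewrite eq_le; apply/andP; split; last first.
    by apply: ler_lim => //; near=> t; exact: ab.
  have cDN : (fun t => b (t + N)%N - a (t + N)%N) @ \oo --> limn b - limn a.
    by rewrite (cvg_shiftn N (fun t => b t - a t)).
  have cc : (fun t => (1 - c) * (b t - a t)) @ \oo -->
      (1 - c) * (limn b - limn a) by exact: cvgMr.
  have : limn b - limn a <= (1 - c) * (limn b - limn a).
    by apply: ler_cvg_to cDN cc _; near=> t; exact: contr.
  nra.
exists (limn a) => i; apply: (@squeeze_cvgr _ _ _ _ a b).
- by near=> t; rewrite ax xb.
- exact: ca.
- by rewrite -lim_eq; exact: cb.
Unshelve. all: by end_near. Qed.

Lemma stochasticX_gt0 P i j k s t : stochastic P ->
  0 < (P ^+ s) i j -> 0 < (P ^+ t) j k -> 0 < (P ^+ (s + t)) i k.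
Proof.
move=> sP Pij Pjk; rewrite exprD -mulmxE mxE (bigD1 j)//=.
rewrite ltr_pwDl ?mulr_gt0// sumr_ge0// => l _.
by rewrite mulr_ge0//; [case: (stochasticX s sP)|case: (stochasticX t sP)].
Qed.

End StochasticMatrix.

(** * Trajectory laws and powers of the transition matrix *)

Section Occupation.
Variables (R : realType) (S A : finType) (M : mdp R S A).
Implicit Types (u v : S -> A -> R).

(** Deleting the last pair is a bijection from the trajectories ending in (s, a) to those one step
    shorter, which are then grouped by their own last pair. *)
Lemma occ_probS u s0 t s a : occ_prob M u s0 t.+1 s a =
  \sum_x occ_prob M u s0 t x.1 x.2 * trans M x.1 x.2 s * u s a.
Proof.
pose ext (w : {ffun 'I_t.+1 -> S * A}) : {ffun 'I_t.+2 -> S * A} :=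
  [ffun k => if unlift ord_max k is Some k' then w k' else (s, a)].
pose res (w : {ffun 'I_t.+2 -> S * A}) : {ffun 'I_t.+1 -> S * A} :=
  [ffun k => w (lift ord_max k)].
have ext_lift w (k : 'I_t.+1) : ext w (lift ord_max k) = w k.
  by rewrite ffunE liftK.
have ext_max w : ext w ord_max = (s, a) by rewrite ffunE unlift_none.
have lift_widen m (k : 'I_m) : lift ord_max k = widen_ord (leqnSn m) k.
  by apply: val_inj; exact: lift_max.
have traj_ext w : traj_prob M u s0 (ext w) =
    traj_prob M u s0 w * trans M (w ord_max).1 (w ord_max).2 s * u s a.
  rewrite /traj_prob.
  have -> : ext w ord0 = w ord0.
    by rewrite -(ext_lift w ord0); congr (ext w _); apply: val_inj.
  rewrite [X in _ * X * _]big_ord_recr/= ext_max/=.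
  under [X in _ * (X * _) * _]eq_bigr => k _.
    rewrite -lift_widen ext_lift.
  over.
  rewrite [X in _ * X = _]big_ord_recr/=.
  under [X in _ * (X * _) = _]eq_bigr => k _.
    rewrite -lift_widen ext_lift.
    have -> : lift ord0 (widen_ord (leqnSn t) k) = lift ord_max (lift ord0 k).
      by rewrite lift_widen; apply: val_inj.
    rewrite ext_lift.
  over.
  rewrite -lift_widen ext_lift.
  have -> : lift ord0 ord_max = ord_max :> 'I_t.+2 by apply: val_inj.
  rewrite ext_max/=; ring.
rewrite /occ_prob (reindex_onto ext res)/=; last first.
  move=> w /eqP w_max; apply/ffunP => k; rewrite ffunE.
  by case: unliftP => [k' ->|->]; rewrite ?ffunE.
under eq_bigl => w.
  have -> : res (ext w) = w by apply/ffunP => k; rewrite ffunE ext_lift.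
  rewrite ext_max !eqxx.
over.
rewrite (partition_big (fun w : {ffun 'I_t.+1 -> S * A} => w ord_max) xpredT)//=.
apply: eq_bigr => -[s1 a1] _ /=; rewrite !mulr_suml; apply: eq_bigr => w /eqP wE.
by rewrite traj_ext wE.
Qed.

Lemma chain_mxE v s s' : chain_mx M v (enum_rank s) (enum_rank s') =
  \sum_(a in adm M s) v s a * trans M s a s'.
Proof. by rewrite mxE !enum_rankK. Qed.

Lemma RS_sum v s : RS_policies M v -> \sum_a v s a = 1.
Proof.
move=> /(_ s)[_ v0 <-]; rewrite [LHS](bigID (mem (adm M s)))/=.
by rewrite [X in _ + X]big1 ?addr0// => a /v0.
Qed.

Lemma sum_enum_val (F : 'I_#|S| -> R) : \sum_i F i = \sum_s F (enum_rank s).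
Proof.
rewrite (reindex (@enum_rank S))//.
by exists enum_val => ? _; rewrite (enum_rankK, enum_valK).
Qed.

Lemma occ_probE v s0 t s a : RS_policies M v ->
  occ_prob M v s0 t s a = step_prob (chain_mx M v) t s0 s * v s a.
Proof.
move=> vRS; elim: t s a => [|t IH] s a.
  rewrite /occ_prob (big_pred1 [ffun=> (s, a)]) => [|w]; last first.
    apply/eqP/eqP => [wE|->]; last by rewrite ffunE.
    by apply/ffunP => k; rewrite ffunE -wE (ord1 k) (ord1 ord_max).
  rewrite /traj_prob /step_prob big_ord1 big_ord0 !ffunE/= mulr1 expr0 mxE.
  by rewrite (inj_eq enum_rank_inj) eq_sym.
rewrite occ_probS -big_distrl/=; congr (_ * _).
rewrite /step_prob exprSr -mulmxE mxE sum_enum_val.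
rewrite -(pair_bigA _ (fun s a => occ_prob M v s0 t s a * trans M s a _))/=.
apply: eq_bigr => s1 _; rewrite chain_mxE mulr_sumr [LHS](bigID (mem (adm M s1)))/=.
rewrite [X in _ + X]big1 ?addr0 => [|a1 a1N].
  by apply: eq_bigr => a1 _; rewrite IH mulrA.
by rewrite IH; have [_ -> //] := vRS s1; rewrite mulr0 mul0r.
Qed.

Lemma chain_stochastic v : RS_policies M v -> stochastic (chain_mx M v).
Proof.
move=> vRS; split=> i => [j|].
  rewrite mxE sumr_ge0// => a aM; rewrite mulr_ge0 ?(trans_ge0 aM)//.
  by have [] := vRS (enum_val i).
have [_ _ <-] := vRS (enum_val i).
under eq_bigr do rewrite mxE.
rewrite exchange_big/=; apply: eq_bigr => a aM.
rewrite -mulr_sumr sum_enum_val.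
under eq_bigr do rewrite enum_rankK.
by rewrite (trans_sum1 aM) mulr1.
Qed.

End Occupation.

(** * Limit laws and occupation measures *)

Section Steady.
Variables (R : realType) (S A : finType) (M : mdp R S A).
Implicit Types (v : S -> A -> R) (m : S -> R).

(** By aperiodicity [s0] returns to itself at all large times. Prefixing a path to [s0] from each
    state gives one power with a positive column at [s0], whose least entry (capped by 1) is
    Doeblin's constant. *)
Lemma ergodic_cvg v (s0 : S) : RS_policies M v -> ergodic_chain (chain_mx M v) ->
  exists m, forall s s', (fun t => step_prob (chain_mx M v) t s s') @ \oo --> m s'.
Proof.
move=> vRS [irr aper]; set Q := chain_mx M v.
have sQ : stochastic Q := chain_stochastic vRS.
have [N0 N0P] : exists N, forall n, (N <= n)%N -> 0 < step_prob Q n s0 s0.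
  apply: semigroup_cofinite => [m n|d dP]; first exact: stochasticX_gt0.
  exact: aper dP.
pose hit s := projT1 (cid (irr s s0)).
have hitP s : 0 < step_prob Q (hit s) s s0 by rewrite /hit; case: cid.
pose N := (N0 + \max_s hit s)%N; pose k := enum_rank s0.
have QN i : 0 < (Q ^+ N) i k.
  have le_hit : (hit (enum_val i) <= \max_s hit s)%N by exact: leq_bigmax.
  rewrite (_ : N = hit (enum_val i) + (N - hit (enum_val i)))%N; last first.
    by rewrite /N; lia.
  apply: (@stochasticX_gt0 _ _ _ _ k) => //; last by apply: N0P; rewrite /N; lia.
  by have := hitP (enum_val i); rewrite /step_prob enum_valK.
have [pi piP] := @doeblin_cvg R _ Q N k (\big[Order.min/1]_i (Q ^+ N) i k) sQ
  (introT (bigmin_gtP _ _ _ _) (conj ltr01 (fun i _ => QN i)))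
  (fun i => bigmin_le _ i _).
by exists (fun s => pi (enum_rank s)) => s s'; exact: piP.
Qed.

Definition stationary v m : Prop := \sum_s m s = 1 /\
  forall s', \sum_s m s * (\sum_(a in adm M s) v s a * trans M s a s') = m s'.

Lemma stationary_step v m t s' : stationary v m ->
  \sum_s m s * step_prob (chain_mx M v) t s s' = m s'.
Proof.
move=> [_ mst]; elim: t s' => [|t IH] s'.
  rewrite (bigD1 s')//= /step_prob expr0 mxE eqxx mulr1 big1 ?addr0// => s ss'.
  by rewrite mxE (inj_eq enum_rank_inj) (negbTE ss') mulr0.
under eq_bigr do rewrite /step_prob exprSr -mulmxE mxE sum_enum_val mulr_sumr.
rewrite exchange_big/= -[RHS]mst; apply: eq_bigr => s _; rewrite -[in RHS]IH.
by rewrite mulr_suml; apply: eq_bigr => s1 _; rewrite chain_mxE mulrA.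
Qed.

Section Limit.
Variables (v : S -> A -> R) (m : S -> R) (s0 : S).
Hypothesis vRS : RS_policies M v.
Hypothesis m_lim :
  forall s s', (fun t => step_prob (chain_mx M v) t s s') @ \oo --> m s'.

Lemma limit_ge0 s : 0 <= m s.
Proof.
apply: (cvgr_to_ge (@m_lim s0 s)); near=> t.
by case: (stochasticX t (chain_stochastic vRS)) => + _; apply.
Unshelve. all: by end_near. Qed.

(** Finite sums commute with the limit, in the row sums and in Q^(t+1) = Q^t Q. *)
Lemma limit_stationary : stationary v m.
Proof.
split.
  have c1 : (fun t => \sum_s step_prob (chain_mx M v) t s0 s) @ \oo -->
      \sum_s m s.
    apply: cvg_big => [|s _]; [exact: add_continuous|exact: m_lim].
  have E : (fun t => \sum_s step_prob (chain_mx M v) t s0 s) = fun=> 1.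
    apply/funext => t; rewrite -sum_enum_val.
    by case: (stochasticX t (chain_stochastic vRS)).
  by rewrite E in c1; apply/esym/(cvg_unique (@norm_hausdorff _ _) (@cvg_cst _ (1 : R) _ \oo _) c1).
move=> s'.
have c1 : (fun t => \sum_s step_prob (chain_mx M v) t s0 s *
      (\sum_(a in adm M s) v s a * trans M s a s')) @ \oo -->
    \sum_s m s * (\sum_(a in adm M s) v s a * trans M s a s').
  apply: cvg_big => [|s _]; first exact: add_continuous.
  by apply: cvgMl; exact: m_lim.
apply: (cvg_unique (@norm_hausdorff _ _) c1).
have := @m_lim s0 s'; rewrite -cvg_shiftS.
under eq_fun => t.
  rewrite /step_prob exprSr -mulmxE mxE sum_enum_val.
  under eq_bigr do rewrite chain_mxE.
over.
by [].
Qed.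

(** Invariance gives m' Q^t = m' for all t, and m' Q^t tends to m because m' has total mass 1. *)
Lemma stationary_unique m' : stationary v m' -> m' = m.
Proof.
move=> st'; apply/funext => s'.
have c1 : (fun t => \sum_s m' s * step_prob (chain_mx M v) t s s') @ \oo -->
    \sum_s m' s * m s'.
  apply: cvg_big => [|s _]; first exact: add_continuous.
  by apply: cvgMr; exact: m_lim.
move: c1; rewrite -mulr_suml st'.1 mul1r.
under eq_fun do rewrite (stationary_step _ _ st').
by move=> c1; apply: (cvg_unique (@norm_hausdorff _ _) (@cvg_cst _ (m' s') _ \oo _) c1).
Qed.

Lemma steady_limit s a : steady M s0 v s a = m s * v s a.
Proof.
apply: cvg_lim => //; under eq_fun do rewrite occ_probE//.
by apply: cvgMl; exact: m_lim.
Qed.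

End Limit.

Lemma steadyE v s0 m s a : RS_policies M v -> ergodic_chain (chain_mx M v) ->
  stationary v m -> steady M s0 v s a = m s * v s a.
Proof.
move=> vRS erg st; have [p p_lim] := ergodic_cvg s0 vRS erg.
by rewrite (stationary_unique p_lim st); exact: steady_limit.
Qed.

(** The feasible set of the linear program of state-action frequencies; the last condition is flow
    balance. *)
Definition occ_polytope : set (S * A -> R) :=
  [set x | [/\ forall y, 0 <= x y,
               forall s a, a \notin adm M s -> x (s, a) = 0,
               \sum_y x y = 1
             & forall s', \sum_y x y * trans M y.1 y.2 s' = \sum_a x (s', a)]].

Lemma steady_occ_polytope v s0 :
  RS_policies M v -> ergodic_chain (chain_mx M v) ->
  occ_polytope (fun y => steady M s0 v y.1 y.2).
Proof.
move=> vRS erg; have [m m_lim] := ergodic_cvg s0 vRS erg.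
have m_ge0 := limit_ge0 s0 vRS m_lim.
have [m1 mst] := limit_stationary s0 vRS m_lim.
have E := steady_limit s0 vRS m_lim.
split=> [[s a]|s a aN||s'] /=.
- by rewrite E mulr_ge0//; case: (vRS s).
- by rewrite E; case: (vRS s) => _ -> //; rewrite mulr0.
- rewrite -(pair_bigA _ (fun s a => steady M s0 v s a))/= -m1.
  apply: eq_bigr => s _; under eq_bigr do rewrite E.
  by rewrite -mulr_sumr (RS_sum s vRS) mulr1.
- under [RHS]eq_bigr do rewrite E.
  rewrite -mulr_sumr (RS_sum s' vRS) mulr1 -[RHS]mst.
  rewrite -(pair_bigA _ (fun s a => steady M s0 v s a * trans M s a s'))/=.
  apply: eq_bigr => s _; rewrite mulr_sumr [LHS](bigID (mem (adm M s)))/=.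
  rewrite [X in _ + X]big1 ?addr0 => [|a aN].
    by apply: eq_bigr => a _; rewrite E mulrA.
  by rewrite E; case: (vRS s) => _ -> // _; rewrite mulr0 mul0r.
Qed.

(* Conditioning on the state turns a point of the polytope into a policy; at  *)
(* states of mass 0 any admissible action will do.                            *)
Lemma occ_polytope_steady x s0 :
  (forall v, RS_policies M v -> ergodic_chain (chain_mx M v)) ->
  occ_polytope x ->
  exists2 v, RS_policies M v & forall s a, steady M s0 v s a = x (s, a).
Proof.
move=> erg [x_ge0 xN x1 xst].
pose m s := \sum_a x (s, a).
pose a0 s := xchoose (adm_nonempty M s).
have a0P s : a0 s \in adm M s by exact: xchooseP.
pose v s a := if m s == 0 then (a == a0 s)%:R else x (s, a) / m s.
have m_ge0 s : 0 <= m s by exact: sumr_ge0.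
have xE s a : m s * v s a = x (s, a).
  rewrite /v; case: eqP => [m0|/eqP m0]; last by rewrite mulrC divfK.
  rewrite m0 mul0r; apply/esym.
  by apply/eqP; move/eqP: m0; rewrite psumr_eq0// => /allP/(_ a (mem_index_enum a)).
have adm_sum s (F : A -> R) : (forall a, a \notin adm M s -> F a = 0) ->
    \sum_(a in adm M s) F a = \sum_a F a.
  move=> F0; rewrite [RHS](bigID (mem (adm M s)))/=.
  by rewrite [X in _ = _ + X]big1 ?addr0// => a /F0.
have vRS : RS_policies M v.
  move=> s; have vN a : a \notin adm M s -> v s a = 0.
    move=> aN; rewrite /v; case: eqP => _; last by rewrite xN ?mul0r.
    by case: eqP aN => // ->; rewrite a0P.
  split=> // [a|].
    by rewrite /v; case: ifP => _; rewrite ?ler0n// divr_ge0.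
  rewrite adm_sum// /v; case: eqP => [m0|/eqP m0].
    by rewrite (bigD1 (a0 s))//= eqxx big1 ?addr0// => a /negbTE ->.
  by rewrite -mulr_suml divff.
exists v => // s a; rewrite (@steadyE v s0 m)//; first exact: erg.
split=> [|s']; first by rewrite -x1 (pair_bigA _ (fun s a => x (s, a)))/=; apply: eq_bigr => -[].
rewrite -[RHS]xst.
transitivity (\sum_s \sum_a x (s, a) * trans M s a s').
  apply: eq_bigr => s1 _; rewrite mulr_sumr adm_sum => [|a1 a1N].
    by apply: eq_bigr => a1 _; rewrite mulrA xE.
  by rewrite mulrA xE xN ?mul0r.
rewrite (pair_bigA _ (fun s a => x (s, a) * trans M s a s'))/=.
by apply: eq_bigr => -[].
Qed.

End Steady.

(** * Compactness of the occupation polytope *)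

Section Compactness.
Import ArrowAsProduct.
Variables (R : realType) (S A : finType) (M : mdp R S A).

Let X := prod_topology (fun _ : S * A => R).

Lemma sum_coord_continuous (P : pred (S * A)) (c : S * A -> R) :
  continuous (fun x : X => \sum_(y | P y) x y * c y).
Proof.
apply: continuous_big => [|y _]; first exact: add_continuous.
have cy : continuous (fun x : X => x y).
  exact: (@proj_continuous _ (fun _ : S * A => R)).
by move=> x; apply: (@cvgMl _ _ (nbhs x)); exact: cy.
Qed.

(** Nonnegativity and mass 1 put the polytope in the unit cube, compact by Tychonoff; the remaining
    conditions are closed linear equations. *)
Lemma occ_polytope_compact : compact (occ_polytope M : set X).
Proof.
have box : compact [set x : X | forall y, `[0, 1]%classic (x y)].
  apply: (@tychonoff _ (fun _ : S * A => R) (fun=> `[0, 1]%classic)) => y.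
  exact: segment_compact.
(* Flow balance as the vanishing of a single weighted sum, the shape covered by
   [sum_coord_continuous]. *)
pose bal (x : X) s' :=
  \sum_y x y * (trans M y.1 y.2 s' - (y.1 == s')%:R).
pose C : set X := (fun x : X => \sum_y x y * 1) @^-1` [set 1] `&`
  \bigcap_(i in [set: S + {y : S * A | y.2 \notin adm M y.1}])
    (match i with
     | inl s' => bal^~ s' @^-1` [set 0]
     | inr y => (fun x : X => x (val y)) @^-1` [set 0]
     end).
have closedC : closed C.
  apply: closedI.
    apply: (continuous_closedP _).1; last exact: closed_eq.
    exact: sum_coord_continuous.
  apply: closed_bigI => -[s'|y] _; apply: (continuous_closedP _).1;
    try exact: closed_eq.
  - exact: sum_coord_continuous.
  - exact: (@proj_continuous _ (fun _ : S * A => R) (val y)).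
suff -> : occ_polytope M = [set x : X | forall y, `[0, 1]%classic (x y)] `&` C.
  exact: compact_closedI.
have balE x s' :
    bal x s' = \sum_y x y * trans M y.1 y.2 s' - \sum_a x (s', a).
  rewrite /bal; under eq_bigr do rewrite mulrBr.
  rewrite sumrB; congr (_ - _).
  transitivity (\sum_s \sum_a x (s, a) * (s == s')%:R).
    by rewrite pair_bigA/=; apply: eq_bigr => -[].
  rewrite (bigD1 s')//= eqxx [X in _ + X]big1 ?addr0 => [|s /negbTE ->].
    by apply: eq_bigr => a _; rewrite mulr1.
  by rewrite big1// => a _; rewrite mulr0.
apply/seteqP; split=> x /=.
  move=> [x0 xN x1 xst]; split.
    move=> y; rewrite /= in_itv/= x0/= -x1 (bigD1 y)//= lerDl.
    exact: sumr_ge0.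
  split; first by rewrite /= -[RHS]x1; apply: eq_bigr => y _; rewrite mulr1.
  move=> [s'|[[s a] /= yN]] _ /=; last exact: xN.
  by rewrite balE xst subrr.
move=> [x01 [/= x1 xC]]; split=> [y|s a aN||s'].
- by have := x01 y; rewrite /= in_itv/= => /andP[].
- exact: (xC (inr (exist _ (s, a) aN)) I).
- by rewrite -[RHS]x1; apply: eq_bigr => y _; rewrite mulr1.
- by have /eqP := xC (inl s') I; rewrite /= balE subr_eq0 => /eqP.
Qed.

End Compactness.

(** * The steady-state cost distribution and its supremum *)

Section CostDistribution.
Variables (R : realType) (S A : finType) (M : mdp R S A) (s0 : S).
Hypothesis ergodic :
  forall v, RS_policies M v -> ergodic_chain (chain_mx M v).
Implicit Types (v : S -> A -> R) (l : R).

Lemma RS_of_DS_policy u : DS_policies M u -> RS_policies M (RS_of_DS R u).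
Proof.
move=> uDS s; split=> [a|a aN|]; rewrite /RS_of_DS.
- exact: ler0n.
- by case: eqP aN => // ->; rewrite uDS.
- by rewrite (bigD1 (u s))//= eqxx big1 ?addr0// => a /andP[_ /negbTE ->].
Qed.

Lemma cost_cdfE v l : cost_cdf M s0 v l =
  \sum_(y | (y.2 \in adm M y.1) && (cost M y.1 y.2 <= l)) steady M s0 v y.1 y.2.
Proof. by rewrite /cost_cdf pair_big_dep. Qed.

Lemma steady_ge0 v s a : RS_policies M v -> 0 <= steady M s0 v s a.
Proof.
move=> vRS; have [/(_ (s, a)) + _ _ _] := steady_occ_polytope s0 vRS (ergodic vRS).
by apply.
Qed.

Lemma cost_cdf_le1 v l : RS_policies M v -> cost_cdf M s0 v l <= 1.
Proof.
move=> vRS; have [x0 _ x1 _] := steady_occ_polytope s0 vRS (ergodic vRS).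
rewrite cost_cdfE -x1 [leRHS](bigID (fun y : S * A =>
  (y.2 \in adm M y.1) && (cost M y.1 y.2 <= l)))/= lerDl.
by apply: sumr_ge0 => y _; exact: x0.
Qed.

(** The levels are compared through the costs below them, since [l'] may be a left predecessor that
    is smaller than [l]. *)
Lemma cost_cdf_mono v l l' : RS_policies M v ->
  (forall s a, a \in adm M s -> cost M s a <= l -> cost M s a <= l') ->
  cost_cdf M s0 v l <= cost_cdf M s0 v l'.
Proof.
move=> vRS ll'; rewrite /cost_cdf; apply: ler_sum => s _.
rewrite big_mkcond [leRHS]big_mkcond; apply: ler_sum => a _ /=.
case: (boolP (a \in adm M s)) => //= aM.
case: ifP => [/(ll' _ _ aM) ->//|_].
by case: ifP => // _; exact: steady_ge0.
Qed.

Lemma cost_cdf_eq1 v l : RS_policies M v ->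
  (forall s a, a \in adm M s -> cost M s a <= l) -> cost_cdf M s0 v l = 1.
Proof.
move=> vRS le_l; have [_ xN x1 _] := steady_occ_polytope s0 vRS (ergodic vRS).
rewrite cost_cdfE -x1 big_mkcond/=; apply: eq_bigr => -[s a] _ /=.
case: (boolP (a \in adm M s)) => [aM|aN] /=; first by rewrite le_l.
by rewrite (xN _ _ aN).
Qed.

Lemma cost_cdf_eq0 v l :
  (forall s a, a \in adm M s -> l < cost M s a) -> cost_cdf M s0 v l = 0.
Proof.
move=> lt_l; rewrite cost_cdfE big_pred0// => -[s a] /=.
by apply/negP => /andP[/lt_l]; rewrite ltNge => /negP.
Qed.

Lemma Fstar_ge v l : RS_policies M v -> cost_cdf M s0 v l <= Fstar M s0 l.
Proof.
move=> vRS; apply: ub_le_sup; last by exists v.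
by exists 1 => _ [w wRS <-]; exact: cost_cdf_le1.
Qed.

Lemma exists_DS : exists u, DS_policies M u.
Proof. by exists (fun s => xchoose (adm_nonempty M s)) => s; exact: xchooseP. Qed.

(* [cost_cdf M s0 v l] is a linear functional of the occupation measure of v. *)
Lemma Fstar_attained l :
  exists2 v, RS_policies M v & cost_cdf M s0 v l = Fstar M s0 l.
Proof.
pose F (x : S * A -> R) :=
  \sum_(y | (y.2 \in adm M y.1) && (cost M y.1 y.2 <= l)) x y * 1.
have FE v : cost_cdf M s0 v l = F (fun y => steady M s0 v y.1 y.2).
  by rewrite cost_cdfE; apply: eq_bigr => y _; rewrite mulr1.
have [u0 /RS_of_DS_policy u0RS] := exists_DS.
have [|x /set_mem xK xmax] := compact_EVT_max _ (@occ_polytope_compact _ _ _ M)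
    (continuous_subspaceT (@sum_coord_continuous _ _ _
      (fun y => (y.2 \in adm M y.1) && (cost M y.1 y.2 <= l)) (fun=> 1))).
  exists (fun y => steady M s0 (RS_of_DS R u0) y.1 y.2).
  exact: steady_occ_polytope (ergodic u0RS).
have [v vRS vE] := occ_polytope_steady s0 ergodic xK.
exists v => //; apply/eqP; rewrite eq_le Fstar_ge//=.
apply: ge_sup; first by exists (cost_cdf M s0 v l), v.
move=> _ [w wRS <-]; rewrite !FE.
rewrite [leRHS](_ : _ = F x).
  by apply: xmax; apply/mem_set; exact: steady_occ_polytope (ergodic wRS).
by apply: eq_bigr => -[s a] _ /=; rewrite vE.
Qed.

Lemma cost_values_nonempty : cost_values M !=set0.
Proof. by have [a aM] := adm_nonempty M s0; exists (cost M s0 a), s0, a. Qed.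

Lemma cost_values_bounded : exists b, forall s a, `|cost M s a| <= b.
Proof.
exists (\big[Order.max/0]_(y : S * A) `|cost M y.1 y.2|) => s a.
exact: (le_bigmax _ (fun y : S * A => `|cost M y.1 y.2|) (s, a)).
Qed.

Lemma has_lbound_cost_values : has_lbound (cost_values M).
Proof.
have [b bP] := cost_values_bounded; exists (- b) => _ [s [a [_ ->]]].
by have := bP s a; rewrite ler_norml => /andP[].
Qed.

Lemma left_pred_lt l : left_pred (cost_values M) l < l.
Proof.
rewrite /left_pred; case: ifPn => [inf_l|_]; last by rewrite ltrBlDr ltrDl.
pose p (y : S * A) := (y.2 \in adm M y.1) && (cost M y.1 y.2 < l).
(* A finite maximum of numbers below [l], default included, stays below [l], whereas a supremum
   alone would only give <=. *)
pose b := \big[Order.max/l - 1]_(y | p y) cost M y.1 y.2.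
have b_lt : b < l.
  by apply/bigmax_ltP; split=> [|y /andP[]//]; rewrite ltrBlDr ltrDl.
apply: le_lt_trans b_lt; apply: ge_sup.
  have [_ [s [a [aM ->]]] lt_l] := inf_lt cost_values_nonempty inf_l.
  by exists (cost M s a); split=> //; exists s, a.
move=> _ [[s [a [aM ->]]] lt_l].
apply: (@le_bigmax_cond _ _ _ _ (s, a) p (fun y => cost M y.1 y.2)).
by rewrite /p/= aM.
Qed.

Lemma le_left_pred s a l :
  a \in adm M s -> cost M s a < l -> cost M s a <= left_pred (cost_values M) l.
Proof.
move=> aM lt_l; have cM : cost_values M (cost M s a) by exists s, a.
rewrite /left_pred (le_lt_trans (ge_inf has_lbound_cost_values cM) lt_l).
by apply: ub_le_sup => //; exists l => y [_ /ltW].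
Qed.

(** * VaR as a quantile *)

Section VaR.
Variable alpha : R.
Hypotheses (alpha_gt0 : 0 < alpha) (alpha_le1 : alpha <= 1).

(** Below all costs F^v is 0 < alpha. Hence the set defining [VaR] is bounded below. *)
Lemma cost_cdf_ge_lbound v l : alpha <= cost_cdf M s0 v l ->
  inf (cost_values M) <= l.
Proof.
move=> al; rewrite leNgt; apply/negP => l_lt; move: al.
rewrite cost_cdf_eq0 ?leNgt ?alpha_gt0// => s a aM.
apply: lt_le_trans l_lt _; apply: ge_inf; first exact: has_lbound_cost_values.
by exists s, a.
Qed.

Lemma VaR_le v l : alpha <= cost_cdf M s0 v l -> VaR M alpha s0 v <= l.
Proof.
move=> al; apply: ge_inf => //; exists (inf (cost_values M)) => l'.
exact: cost_cdf_ge_lbound.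
Qed.

Lemma le_VaR v b : RS_policies M v ->
  (forall l, l < b -> cost_cdf M s0 v l < alpha) -> b <= VaR M alpha s0 v.
Proof.
move=> vRS Fb; apply: lb_le_inf => [|l /= al].
  (* The set defining [VaR] is nonempty: at a bound of all costs F^v is 1 >= alpha. *)
  have [c cP] := cost_values_bounded.
  exists c; rewrite /= cost_cdf_eq1// => s a _.
  exact: le_trans (ler_norm _) (cP s a).
by rewrite leNgt; apply/negP => /Fb; rewrite ltNge al.
Qed.

Lemma VaR_lbound v : RS_policies M v -> inf (cost_values M) <= VaR M alpha s0 v.
Proof.
move=> vRS; apply: le_VaR => // l l_lt; rewrite ltNge; apply/negP.
by move=> /cost_cdf_ge_lbound; rewrite leNgt l_lt.
Qed.

(** For l < b, every cost at most l is at most the left predecessor of b, so F^v(l) is at most F^v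
    there. *)
Lemma le_VaR_left_pred v b : RS_policies M v ->
  cost_cdf M s0 v (left_pred (cost_values M) b) < alpha ->
  b <= VaR M alpha s0 v.
Proof.
move=> vRS Fb; apply: le_VaR => // l lb; apply: le_lt_trans Fb.
apply: cost_cdf_mono => // s a aM cl; apply: le_left_pred => //.
exact: le_lt_trans lb.
Qed.

End VaR.

End CostDistribution.

(** * The improvement and optimality criteria *)

Theorem theorem8 (R : realType) (S A : finType) (M : mdp R S A) (s0 : S)
    (alpha : R) (alpha_gt0 : 0 < alpha) (alpha_le1 : alpha <= 1)
    (ergodic : forall v : S -> A -> R,
       RS_policies M v -> ergodic_chain (chain_mx M v))
    (u : S -> A) (uDS : DS_policies M u) :
  let VaRu := VaR M alpha s0 (RS_of_DS R u) in
  let VaRu_pred := left_pred (cost_values M) VaRu in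
  (forall u' : S -> A, DS_policies M u' ->
     alpha <= cost_cdf M s0 (RS_of_DS R u') VaRu_pred ->
     VaR M alpha s0 (RS_of_DS R u') < VaRu)
  /\
  (VaRu = inf [set VaR M alpha s0 v | v in RS_policies M] <->
     Fstar M s0 VaRu_pred < alpha).
Proof.
move=> VaRu VaRu_pred.
have drop v : alpha <= cost_cdf M s0 v VaRu_pred -> VaR M alpha s0 v < VaRu.
  move=> al; apply: le_lt_trans (left_pred_lt M s0 VaRu).
  exact: VaR_le.
split=> [u' _|]; first exact: drop.
have uRS := RS_of_DS_policy uDS.
have lb : has_lbound [set VaR M alpha s0 v | v in RS_policies M].
  by exists (inf (cost_values M)) => _ [v vRS <-]; exact: VaR_lbound.
split=> [opt|lt_alpha].
  (* If F^* >= alpha, a policy attaining it has VaR strictly below that of [u], against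
     optimality. *)
  rewrite ltNge; apply/negP; have [v vRS <-] := Fstar_attained s0 ergodic VaRu_pred.
  move=> /drop; rewrite opt ltNge => /negP; apply; apply: ge_inf => //.
  by exists v.
apply/eqP; rewrite eq_le; apply/andP; split; last first.
  by apply: ge_inf => //; exists (RS_of_DS R u).
apply: lb_le_inf; first by exists VaRu, (RS_of_DS R u).
move=> _ [v vRS <-]; apply: le_VaR_left_pred => //.
exact: le_lt_trans (Fstar_ge _ _ _ _) lt_alpha.
Qed.
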